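(* Let $q\ge1$ be an integer and, for $n\ge2$, let $X^{(n,q)}$ be a random variable with values in $\mathbf D^{(n,q)}=\{q,q+1,\dots,n+q\}$ and probability mass function $\mathbb P(X^{(n,q)}=j+q-1)=\mathcal T^{(1)}_{n,j}$ for $1\le j\le n+1$. Then $$\operatorname{Var}\left[X^{(n,q)}\right]\to\frac{59}{16}\quad\text{as } n\to\infty.$$
   Context: Define $\psi:\{1,2,3,\dots\}\to\{0,1,2,\dots\}$ by $\psi(1)=0$, $\psi(2)=1$, $\psi(3)=2$ and $\psi(j)=\sum_{k=1}^{j-1}\psi(k)$ for $j\ge 4$. The triangular array $\mathcal T=(\mathcal T_{n,j})$, $n\ge 0$, $1\le j\le n+1$, of integers is defined recursively by: $\mathcal T_{n,n+1}=1$ for every $n\ge 0$; $\mathcal T_{1,1}=1$, $\mathcal T_{2,2}=2$, $\mathcal T_{3,3}=3$; $\mathcal T_{n,n}=\sum_{k=1}^{n-2}\mathcal T_{n-k,n-k}$ for every $n\ge 4$; and $\mathcal T_{n,j}=\mathcal T_{n-1,j}+\psi(j)$ for every $n\ge 2$ and $1\le j\le n-1$. The normalised array is $\mathcal T^{(1)}_{n,j}=2^{-n}\mathcal T_{n,j}$; each of its rows is a probability mass function. *)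

(* Defs.v *)
From HB Require Import structures.
From mathcomp Require Import all_boot all_order all_algebra.
From mathcomp Require Import all_classical all_reals all_analysis.

Set Implicit Arguments.
Unset Strict Implicit.
Unset Printing Implicit Defensive.

Import Order.TTheory GRing.Theory Num.Theory.
Import numFieldNormedType.Exports.

(* [hist_seq f n] is the list [:: u 1; ...; u n] of the sequence u with
   u m.+1 = f m [:: u 1; ...; u m] (course-of-values recursion). *)
Fixpoint hist_seq (f : nat -> seq nat -> nat) (n : nat) : seq nat :=
  if n is m.+1 then let s := hist_seq f m in rcons s (f m s) else [::].

Definition hist_val (f : nat -> seq nat -> nat) (n : nat) : nat :=
  last 0 (hist_seq f n).

(* The values at 0 of [psi] and [tri_diag] are junk: both are indexed from 1.
   The lemmas [psi1] to [psi_rec] and [triSn] to [tri_rec] below are the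
   recursions defining psi and the array T. *)
Definition psi : nat -> nat :=
  hist_val (fun m s => match m with 0 => 0 | 1 => 1 | 2 => 2 | _ => sumn s end).

(* The sub-diagonal T_{n,n}; for n >= 4 the sum defining it runs over
   T_{2,2}, ..., T_{n-1,n-1}, leaving out T_{1,1}. *)
Definition tri_diag : nat -> nat :=
  hist_val
    (fun m s => match m with 0 => 1 | 1 => 2 | 2 => 3 | _ => sumn (behead s) end).

(* T_{n,j}, extended by 0 outside 1 <= j <= n + 1. *)
Fixpoint tri (n j : nat) : nat :=
  if j == n.+1 then 1
  else if n is m.+1 then
    if j == n then tri_diag n
    else if 1 <= j < n then tri m j + psi j
    else 0
  else 0.

Lemma hist_seqE f n : hist_seq f n = [seq hist_val f k | k <- iota 1 n].
Proof.
elim: n => // n IHn.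
rewrite -{2}addn1 iotaD map_cat /= -IHn add1n cats1.
by rewrite /hist_val /= last_rcons.
Qed.

Lemma hist_valS f n :
  hist_val f n.+1 = f n [seq hist_val f k | k <- iota 1 n].
Proof. by rewrite -hist_seqE /hist_val /= last_rcons. Qed.

Lemma psi1 : psi 1 = 0. Proof. by []. Qed.
Lemma psi2 : psi 2 = 1. Proof. by []. Qed.
Lemma psi3 : psi 3 = 2. Proof. by []. Qed.

Lemma psi_rec j : 4 <= j -> psi j = \sum_(1 <= k < j) psi k.
Proof.
case: j => [|[|[|[|j]]]] // _.
by rewrite {1}/psi hist_valS sumnE big_map /index_iota subSS subn0.
Qed.

Lemma triSn n : tri n n.+1 = 1.
Proof. by case: n => [|n] //=; rewrite eqxx. Qed.

Lemma tri_diagE n : 1 <= n -> tri n n = tri_diag n.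
Proof. by case: n => // n _; rewrite /= eqxx -[_ == _.+2]/(n == n.+1) ltn_eqF. Qed.

Lemma tri11 : tri 1 1 = 1. Proof. by []. Qed.
Lemma tri22 : tri 2 2 = 2. Proof. by []. Qed.
Lemma tri33 : tri 3 3 = 3. Proof. by []. Qed.

Lemma tri_diag_rec n :
  4 <= n -> tri n n = \sum_(1 <= k < n.-1) tri (n - k) (n - k).
Proof.
case: n => [|[|[|[|n]]]] // _.
rewrite tri_diagE // {1}/tri_diag hist_valS [iota _ _]/= sumnE.
rewrite -[behead _]/[seq tri_diag k | k <- iota 2 n.+2] big_map.
have -> : iota 2 n.+2 = index_iota 2 n.+4 by rewrite /index_iota !subSS subn0.
rewrite big_nat_rev /= (big_addn 1 n.+4 1) subn1 /=.
apply: eq_big_nat => k /andP[k1 kn].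
rewrite tri_diagE; last by rewrite subn_gt0 (leq_trans kn).
by rewrite addn1 add2n !subSS.
Qed.

Lemma tri_rec n j :
  2 <= n -> 1 <= j <= n.-1 -> tri n j = tri n.-1 j + psi j.
Proof.
case: n => // n _ /andP[j1 jn].
rewrite [tri n.+1 _]/=.
have -> : (j == n.+2) = false by rewrite ltn_eqF // ltnS ltnW.
have -> : (j == n.+1) = false by rewrite ltn_eqF.
by rewrite j1 ltnS jn.
Qed.

Local Open Scope classical_set_scope.
Local Open Scope ring_scope.

Definition tri1 (R : realType) (n j : nat) : R := 2 ^- n * (tri n j)%:R.

Definition support_set (R : realType) (n q : nat) : set R :=
  [set k%:R | k in [set k : nat | (q <= k <= n + q)%N]].

Arguments tri1 R n j : clear implicits.
Arguments support_set R n q : clear implicits.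

(* Main.v *)
Require Import Defs.
From mathcomp Require Import all_boot all_order all_algebra.
From mathcomp Require Import all_classical all_reals all_analysis.
From mathcomp Require Import measurable_realfun zify ring lra.
Import Order.TTheory GRing.Theory Num.Theory.
Import numFieldNormedType.Exports.
Local Open Scope classical_set_scope.
Local Open Scope ring_scope.

(** Seen from its right end, a row of the normalised array has a limit.  The
    recursions solve to [psi j = 3 * 2 ^ (j - 4)] and
    [tri j j = 5 * 2 ^ (j - 4)] for [4 <= j], and down a column [tri] grows by
    [psi j] at each step.  So the entry at distance [i = n - j] from the
    diagonal is [(3 i + 5) * 2 ^ (n - i - 4)], and after division by [2 ^ n] it
    is [(3 i + 5) / 2 ^ (i + 4)], which no longer depends on [n].  These weights
    form a probability law on the naturals with mean 7/4 and second moment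
    27/4, hence with variance 27/4 - 49/16 = 59/16.

    Variance is unchanged by translation and reflection, so the variance of [X]
    is that of [i], a random index whose law is given by the row.  Only four
    entries of a row escape the formula above: [j = n + 1], where [i = -1], and
    [j = 1, 2, 3].  They and the missing tail of the limit law contribute a
    polynomial in [n] divided by [2 ^ n].  The moments of [i] are computed
    exactly in [row_moment1] and [row_moment2]; [variance_finite] turns them
    into the variance of [X], and [quadratic_over_exp2_cvg0] removes the
    errors. *)

(** * Closed forms for the array *)

Lemma psi_closed j : psi (j + 4) = (3 * 2 ^ j)%N.
Proof.
elim: j => // j IHj.
rewrite addSn psi_rec; last by lia.
rewrite big_nat_recr; last by lia.
by rewrite -psi_rec ?leq_addl //= IHj expnS; lia.
Qed.

Lemma tri_diag_closed n : tri (n + 4) (n + 4) = (5 * 2 ^ n)%N.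
Proof.
elim: n => // n IHn.
rewrite addSn tri_diag_rec; last by lia.
rewrite big_ltn; last by lia.
rewrite subSS subn0 big_add1 /=.
under eq_big_nat do rewrite subSS.
by rewrite -tri_diag_rec ?leq_addl // IHn expnS; lia.
Qed.

Lemma tri_column i j :
  (1 <= j)%N -> tri (i + j) j = (tri j j + i * psi j)%N.
Proof.
move=> j1; elim: i => [|i IHi]; first by rewrite addn0.
by rewrite tri_rec ?addSn /= ?IHi; lia.
Qed.

(** Rows are summed from the right: [l] is the distance to the last entry, so
    that [l = i + 1] is at distance [i] from the diagonal.  The entries isolated
    in the last summand are those of [j = n + 1, 3, 2, 1], in this order. *)
Lemma row_sum (R : realType) (F : nat -> R) (k : nat) :
  \sum_(l < k.+4) F l * tri1 R k.+3 (k.+4 - l) =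
  \sum_(i < k) F i.+1 * ((3 * i + 5)%:R / 2 ^+ (i + 4)) +
  (F 0%N + F k.+1 * (2 * k + 3)%:R + F k.+2 * (k + 3)%:R + F k.+3) / 2 ^+ k.+3.
Proof.
rewrite 3!big_ord_recr big_ord_recl /= /tri1.
have -> : (k.+4 - k.+3 = 1)%N by lia.
have -> : (k.+4 - k.+2 = 2)%N by lia.
have -> : (k.+4 - k.+1 = 3)%N by lia.
rewrite subn0 triSn.
have -> : tri k.+3 1 = 1%N.
  by rewrite -(addn1 k.+2) tri_column // tri11 psi1; lia.
have -> : tri k.+3 2 = (k + 3)%N.
  by rewrite -(addn2 k.+1) tri_column // tri22 psi2; lia.
have -> : tri k.+3 3 = (2 * k + 3)%N.
  by rewrite -(addn3 k) tri_column // tri33 psi3; lia.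
have -> : \sum_(i < k) F (bump 0 i) *
      (2 ^- k.+3 * (tri k.+3 (k.+4 - bump 0 i))%:R) =
    \sum_(i < k) F i.+1 * ((3 * i + 5)%:R / 2 ^+ (i + 4)) :> R.
  apply: eq_bigr => i _; rewrite /bump leq0n add1n; congr (_ * _).
  (* The entry has column [m + 4] and row [i + (m + 4)]. *)
  have [m km] : exists m, k = (m + i.+1)%N.
    by exists (k - i.+1)%N; rewrite subnK // ltn_ord.
  have -> : (k.+4 - i.+1 = m + 4)%N by lia.
  have {1 2}-> : k.+3 = (i + (m + 4))%N by lia.
  rewrite tri_column; last by lia.
  rewrite tri_diag_closed psi_closed.
  have -> : (5 * 2 ^ m + i * (3 * 2 ^ m) = (3 * i + 5) * 2 ^ m)%N by lia.
  rewrite natrM natrX -exprVn -exprVn addnCA !exprD !exprVn.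
  by field; rewrite !expf_neq0 // pnatr_eq0.
by ring.
Qed.

(** * Moments of a row *)

(** The right-hand side is the mean 7/4 of the limit law minus its tail, the
    sum over [k <= i].  Substituting [k + i] for [i], the tail is a combination
    of the sums of [i ^ p / 2 ^ i], which are 2, 2 and 6 for [p = 0, 1, 2]. *)
Lemma limit_moment1_partial (R : realType) (k : nat) :
  \sum_(i < k) i%:R * ((3 * i + 5)%:R / 2 ^+ (i + 4)) =
  7 / 4 - (3 * k%:R ^+ 2 + 11 * k%:R + 14) / 2 ^+ k.+3 :> R.
Proof.
elim: k => [|k IHk]; first by rewrite big_ord0; field.
rewrite big_ord_recr /= IHk (addnC k) !exprS natrD natrM -natr1.
by field; rewrite expf_neq0 // pnatr_eq0.
Qed.

(** As for the first moment; the sum of [i ^ 3 / 2 ^ i], which is 26, now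
    enters the tail as well. *)
Lemma limit_moment2_partial (R : realType) (k : nat) :
  \sum_(i < k) i%:R ^+ 2 * ((3 * i + 5)%:R / 2 ^+ (i + 4)) =
  27 / 4 - (3 * k%:R ^+ 3 + 14 * k%:R ^+ 2 + 37 * k%:R + 54) / 2 ^+ k.+3 :> R.
Proof.
elim: k => [|k IHk]; first by rewrite big_ord0; field.
rewrite big_ord_recr /= IHk (addnC k) exprD !(exprS 2) natrD natrM -natr1.
by field; rewrite expf_neq0 // pnatr_eq0.
Qed.

(** The factor [l - 1] is the signed distance to the diagonal.  Choosing the
    origin there makes the bulk of [row_sum] a partial moment of the limit
    law. *)
Lemma row_moment1 (R : realType) (k : nat) :
  \sum_(l < k.+4) (l%:R - 1) * tri1 R k.+3 (k.+4 - l) =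
  7 / 4 - (3 * k%:R + 10) / 2 ^+ k.+3.
Proof.
rewrite (@row_sum R (fun l => l%:R - 1)).
under eq_bigr do rewrite -natr1 addrK.
rewrite limit_moment1_partial (natrD _ (2 * k)) (natrD _ k 3) natrM -!natr1.
by field; rewrite expf_neq0 // pnatr_eq0.
Qed.

Lemma row_moment2 (R : realType) (k : nat) :
  \sum_(l < k.+4) (l%:R - 1) ^+ 2 * tri1 R k.+3 (k.+4 - l) =
  27 / 4 - (5 * k%:R ^+ 2 + 26 * k%:R + 46) / 2 ^+ k.+3.
Proof.
rewrite (@row_sum R (fun l => (l%:R - 1) ^+ 2)).
under eq_bigr do rewrite -natr1 addrK.
rewrite limit_moment2_partial (natrD _ (2 * k)) (natrD _ k 3) natrM -!natr1.
by field; rewrite expf_neq0 // pnatr_eq0.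
Qed.

(** * Random variables with finitely many values *)

(** The fibres of [X] over [s] partition the space, and [g \o X] is constant on
    each of them. *)
Lemma expectation_finite (R : realType) (d : measure_display)
    (T : measurableType d) (P : probability T R) (X : {RV P >-> R})
    (s : seq R) (g : R -> R) :
  uniq s -> (forall w, X w \in s) -> measurable_fun setT g ->
  'E_P[g \o X]%E = (\sum_(r <- s) g r * pmf X r)%:E.
Proof.
move=> us Xs mg.
have XT : \big[setU/set0]_(r <- s) (X @^-1` [set r]) = setT.
  rewrite -subTset => w _; rewrite -bigcup_seq.
  by exists (X w) => //=.
have mX r : measurable (X @^-1` [set r]).
  by rewrite -[_ @^-1` _]setTI; exact: measurable_funP.
rewrite expectation.unlock -XT (@integral_bigsetU_EFin _ _ _ P) //; last 2 first.
- by apply: trivIset_preimage1.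
- rewrite XT; apply/measurable_EFinP; apply: measurableT_comp => //.
rewrite -sumEFin; apply: eq_bigr => r _.
rewrite (eq_integral (fun=> (g r)%:E)); last first.
  by move=> w; rewrite inE /= => ->.
by rewrite integral_cst // EFinM /pmf fineK // fin_num_measure.
Qed.

(** The free constant [c] lets the moments be those of any reflected translate
    [c - X].  The total mass 1 of [pmf X] over [s] comes from the values of [X]
    being in [s]. *)
Lemma variance_finite (R : realType) (d : measure_display)
    (T : measurableType d) (P : probability T R) (X : {RV P >-> R})
    (s : seq R) (c : R) :
  uniq s -> (forall w, X w \in s) ->
  'V_P[X] = (\sum_(r <- s) (c - r) ^+ 2 * pmf X r -
             (\sum_(r <- s) (c - r) * pmf X r) ^+ 2)%:E.
Proof.
move=> us Xs.
(* Expectation of the constant 1. *)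
have mass1 : \sum_(r <- s) pmf X r = 1.
  have := @expectation_finite R d T P X s (cst 1) us Xs (measurable_cst _).
  rewrite (_ : cst 1 \o X = cst 1) // expectation_cst => -[mass].
  by rewrite [RHS]mass; apply: eq_bigr => r _; rewrite mul1r.
have meanE := @expectation_finite R d T P X s id us Xs (@measurable_id _ _ setT).
rewrite /variance covariance.unlock.
set m := \sum_(r <- s) id r * pmf X r in meanE.
have -> : 'E_P[X]%E = m%:E by [].
rewrite /=.
have -> : ((X \- cst m) * (X \- cst m))%R = (fun r => (r - m) ^+ 2) \o X.
  by apply/funext => w /=; rewrite expr2.
rewrite (@expectation_finite _ _ _ _ _ s) //; last first.
  by apply: measurable_funX; apply: measurable_funB.
congr _%:E.
have dev : \sum_(r <- s) (c - r) * pmf X r = c - m.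
  rewrite -[c in RHS]mulr1 -mass1 mulr_sumr -sumrB.
  by apply: eq_bigr => r _; rewrite mulrBl.
rewrite dev.
transitivity (\sum_(r <- s) ((c - r) ^+ 2 * pmf X r
   - (c - m) * (2 * ((c - r) * pmf X r)) + (c - m) ^+ 2 * pmf X r)).
  by apply: eq_bigr => r _; ring.
by rewrite big_split sumrB /= -!mulr_sumr dev mass1; ring.
Qed.

(** * Passage to the limit *)

(** Equality holds at [k = 3], from which on doubling beats the growth of the
    cube. *)
Lemma cube_le_exp2 (k : nat) : (k.+1 ^ 3 <= 8 * 2 ^ k)%N.
Proof.
case: k => [|[|[|k]]] //; elim: k => // k IHk.
have -> : (2 ^ k.+4 = 2 * 2 ^ k.+3)%N by rewrite expnS.
move: (2 ^ k.+3)%N IHk => x; rewrite !(expnS _ 2) !(expnS _ 1) !expn1; nia.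
Qed.

(** By [cube_le_exp2], [(k + 1) ^ 2 / 2 ^ (k + 3)] is at most [1 / (k + 1)]. *)
Lemma quadratic_over_exp2_cvg0 (R : realType) (u : nat -> R) (C : R) :
  (forall k, 0 <= u k <= C * k.+1%:R ^+ 2) ->
  u k / 2 ^+ k.+3 @[k --> \oo] --> (0 : R).
Proof.
move=> uC.
apply: (@squeeze_cvgr _ _ _ _ (fun=> 0) (fun k => C * harmonic k)).
- near=> k; have /andP[u0 uk] := uC k.
  rewrite divr_ge0 ?exprn_ge0 //= ler_pdivrMr ?exprn_gt0 //.
  apply: (le_trans uk); rewrite /harmonic -mulrA ler_wpM2l //.
    have /andP[u00 uk0] := uC 0%N.
    by move: (le_trans u00 uk0); rewrite expr1n mulr1.
  rewrite mulrC ler_pdivlMr ?ltr0n // -exprSr -natrX -natrX ler_nat.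
  by rewrite -(addn3 k) expnD mulnC; exact: cube_le_exp2.
- exact: cvg_cst.
- by rewrite -[X in _ --> X](mulr0 C); apply: cvgMr; exact: cvg_harmonic.
Unshelve. all: by end_near. Qed.

(** With [c] the point where the diagonal entry sits, [c - X] is the signed
    distance to the diagonal. *)
Lemma variance_row (R : realType) (q k : nat) (d : measure_display)
    (T : measurableType d) (P : probability T R) (X : {RV P >-> R}) :
  (forall w, support_set R k.+3 q (X w)) ->
  (forall j, (1 <= j <= k.+4)%N ->
    pmf X (j + q - 1)%:R = tri1 R k.+3 j) ->
  'V_P[X] = (27 / 4 - (5 * k%:R ^+ 2 + 26 * k%:R + 46) / 2 ^+ k.+3 -
             (7 / 4 - (3 * k%:R + 10) / 2 ^+ k.+3) ^+ 2)%:E.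
Proof.
move=> Xdom Xpmf.
pose s : seq R := [seq (k.+3 + q - l)%:R | l <- iota 0 k.+4].
have us : uniq s.
  rewrite map_inj_in_uniq ?iota_uniq // => x y; rewrite !mem_iota => xk yk.
  by move/eqP; rewrite eqr_nat => /eqP; lia.
have Xs w : X w \in s.
  have [j /andP[qj jk] <-] := Xdom w.
  apply/mapP; exists (k.+3 + q - j)%N; first by rewrite mem_iota; lia.
  by congr _%:R; lia.
have sumE (g : R -> R) : \sum_(r <- s) g ((k.+3 + q)%:R - 1 - r) * pmf X r =
    \sum_(l < k.+4) g (l%:R - 1) * tri1 R k.+3 (k.+4 - l).
  rewrite big_map -(big_mkord xpredT
    (fun l => g (l%:R - 1) * tri1 R k.+3 (k.+4 - l))).
  rewrite /index_iota subn0 big_seq [RHS]big_seq; apply: eq_bigr => l.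
  rewrite mem_iota => lk; rewrite -Xpmf; last by lia.
  congr (g _ * pmf X _%:R); last by lia.
  by rewrite natrB; [ring | lia].
rewrite (@variance_finite _ _ _ _ _ s ((k.+3 + q)%:R - 1)) //.
by rewrite (sumE (fun x => x ^+ 2)) (sumE id) row_moment1 row_moment2.
Qed.

Theorem mainTheorem11 (R : realType) (q : nat) (hq : (1 <= q)%N)
    (d : nat -> measure_display) (T : forall n : nat, measurableType (d n))
    (P : forall n : nat, probability (T n) R)
    (X : forall n : nat, {RV (P n) >-> R})
    (hXdom : forall n : nat, (2 <= n)%N ->
       forall w : T n, support_set R n q (X n w))
    (hXpmf : forall n j : nat, (2 <= n)%N -> (1 <= j <= n.+1)%N ->
       pmf (X n) (j + q - 1)%:R = tri1 R n j) :
  'V_(P n)[X n] @[n --> \oo] --> ((59%:R / 16%:R : R)%:E).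
Proof.
(* Rows are written [k + 3]: from row 3 on, the columns 1, 2, 3 and [n + 1]
   isolated in [row_sum] are distinct. *)
rewrite -(cvg_shiftn 3).
rewrite (_ : (fun n => _) = EFin \o (fun k => 27 / 4 -
    (5 * k%:R ^+ 2 + 26 * k%:R + 46) / 2 ^+ k.+3 -
    (7 / 4 - (3 * k%:R + 10) / 2 ^+ k.+3) ^+ 2 : R)); last first.
  apply/funext => k /=; rewrite addn3.
  apply: (@variance_row R q k); first exact: hXdom.
  by move=> j; exact: hXpmf.
apply: cvg_EFin; first exact: nearW.
have -> : 59%:R / 16%:R = 27 / 4 - 0 - (7 / 4 - 0) ^+ 2 :> R by field.
(* 10 and 46 are the constant terms of the two error polynomials; a factor
   [(k + 1) ^ 2] makes room for the remaining coefficients. *)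
have k0 k : 0 <= k%:R :> R by [].
have mean_cvg :
    7 / 4 - (3 * k%:R + 10) / 2 ^+ k.+3 @[k --> \oo] --> (7 / 4 - 0 : R).
  apply: cvgB; first exact: cvg_cst.
  apply: (@quadratic_over_exp2_cvg0 R _ 10) => k.
  by rewrite -natr1; have := k0 k; nra.
apply: cvgB; last exact: (cvgM mean_cvg mean_cvg).
apply: cvgB; first exact: cvg_cst.
apply: (@quadratic_over_exp2_cvg0 R _ 46) => k.
by rewrite -natr1; have := k0 k; nra.
Qed.
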